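(* Let $p\in\mathbb N$, $\alpha_0>-1$, and let $c_1,\dots,c_p>0$ be pairwise distinct. Let $B_n$ and $A^{(i)}_n$ ($i=1,\dots,p$) be the step line multiple Laguerre polynomials of the second kind of type II (monic) and type I defined in the context. Then $$xB_n(x)=B_{n+1}(x)+b^0_nB_n(x)+\sum_{j=1}^pb^j_nB_{n-j}(x)\quad(n\ge0),$$ $$xA^{(i)}_n(x)=A^{(i)}_{n-1}(x)+b^0_{n-1}A^{(i)}_n(x)+\sum_{j=1}^pb^j_{n+j-1}A^{(i)}_{n+j}(x)\quad(n\ge1,\ i\in\{1,\dots,p\}),$$ with the convention $B_r=0$ for $r<0$, where for $m\ge0$ and $k\in\{0,\dots,p-1\}$, $$b^0_{pm+k}=\frac{\alpha_0+pm+k+1}{c_{k+1}}+\sum_{i=1}^k\frac{m+1}{c_i}+\sum_{i=k+1}^p\frac{m}{c_i};$$ for $j\in\{1,\dots,k\}$, $$b^j_{pm+k}=(-1)^{j+1}(\alpha_0+pm+k-j+1)_j\left(\sum_{i=1}^{k+1-j}\frac{m+1}{c_i^{j+1}}\prod_{q=k+2-j}^k\frac{c_i-c_q}{c_q}+\sum_{i=k+1}^p\frac{m}{c_i^{j+1}}\prod_{q=k+2-j}^k\frac{c_i-c_q}{c_q}\right);$$ and for $j\in\{k+1,\dots,p\}$, $$b^j_{pm+k}=(-1)^{j+1}(\alpha_0+pm+k-j+1)_j\sum_{i=k+1}^{p+k+1-j}\frac{m}{c_i^{j+1}}\prod_{q=1}^k\frac{c_i-c_q}{c_q}\prod_{q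=p+k+2-j}^p\frac{c_i-c_q}{c_q}.$$
   Context: $\mathbb N_0=\{0,1,2,\dots\}$; $|\vec n|=n_1+\cdots+n_p$; $(x)_0=1$, $(x)_n=x(x+1)\cdots(x+n-1)$; empty products equal $1$ and empty sums equal $0$. The multiple Laguerre polynomials of the second kind are the multiple orthogonal polynomials for the weights $x^{\alpha_0}e^{-c_ix}$, $i=1,\dots,p$, with respect to $dx$ on $[0,\infty)$. For $\vec n=(n_1,\dots,n_p)\in\mathbb N_0^p$: Type II (monic, degree $|\vec n|$): $$L_{\vec n}(x)=(-1)^{|\vec n|}(\alpha_0+1)_{|\vec n|}\sum_{l_1=0}^{n_1}\cdots\sum_{l_p=0}^{n_p}\frac{1}{(\alpha_0+1)_{l_1+\cdots+l_p}}\prod_{q=1}^p\frac{(-n_q)_{l_q}c_q^{l_q-n_q}}{l_q!}\;x^{l_1+\cdots+l_p}.$$ Type I: $L^{(i)}_{\vec n}=0$ if $n_i=0$, and if $n_i\ge1$, $$L^{(i)}_{\vec n}(x)=\frac{(-1)^{n_i-1}c_i^{\alpha_0+|\vec n|}(\alpha_0+|\vec n|-n_i+1)_{n_i-1}}{(n_i-1)!\,\Gamma(\alpha_0+|\vec n|)}\prod_{q\ne i}\left(\frac{c_q}{c_q-c_i}\right)^{n_q}\sum_{\substack{l_1,\dots,l_p\ge0\\ l_1+\cdots+l_p\le n_i-1}}\frac{(-n_i+1)_{l_1+\cdots+l_p}}{(\alpha_0+|\vec n|-n_i+1)_{l_1+\cdots+l_p}}\frac{c_i^{l_1+\cdots+l_p}}{l_i!}\prod_{q\ne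 i}\frac{(n_q)_{l_q}}{l_q!\,(c_i-c_q)^{l_q}}\;x^{l_i}.$$ Step line: for $m\ge0$, $k\in\{0,\dots,p-1\}$, let $\vec n(pm+k)$ be the multi-index whose first $k$ entries are $m+1$ and whose remaining $p-k$ entries are $m$; put $B_n=L_{\vec n(n)}$ and $A^{(i)}_n=L^{(i)}_{\vec n(n)}$ (in particular $A^{(i)}_0=0$). *)

(* Defs.v *)
From HB Require Import structures.
From mathcomp Require Import all_boot all_order all_algebra.
From mathcomp Require Import all_classical all_reals all_analysis.

Set Implicit Arguments.
Unset Strict Implicit.
Unset Printing Implicit Defensive.

Import Order.TTheory GRing.Theory Num.Theory.
Import numFieldNormedType.Exports.

Local Open Scope ring_scope.

(* Indices i = 1..p of the mathematical text are shifted to 0..p-1 ('I_p)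
   throughout: c_i is [c (i-1)], and likewise for multi-indices. *)

Definition pochhammer (R : realType) (x : R) (n : nat) : R :=
  \prod_(i < n) (x + i%:R).

(* Meaningful for x > 0 only; elsewhere the integral diverges. *)
Definition Gamma (R : realType) (x : R) : R :=
  (\int[lebesgue_measure]_(t in `[0%R, +oo[%classic)
     (t `^ (x - 1) * expR (- t)))%R.

Definition msize (p : nat) (n : 'I_p -> nat) : nat := (\sum_(q < p) n q)%N.

(* The summation variable l ranges over the l with l_q <= n_q for all q;
   l_q <= |n| is only the bound that makes its type finite. *)
Definition laguerreII (R : realType) (p : nat) (a0 : R) (c : 'I_p -> R)
    (n : 'I_p -> nat) : {poly R} :=
  ((-1) ^+ msize n * pochhammer (a0 + 1) (msize n)) *:
  \sum_(l : {ffun 'I_p -> 'I_(msize n).+1} | [forall q, (l q <= n q)%N])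
    ((pochhammer (a0 + 1) (\sum_(q < p) l q)%N)^-1 *
     \prod_(q < p) (pochhammer (- (n q)%:R) (l q) *
                    c q ^ ((l q)%:Z - (n q)%:Z) / (l q)`!%:R))
    *: 'X^(\sum_(q < p) l q)%N.

(* Here l_1 + ... + l_p <= n_i - 1 already forces l_q < n_i. *)
Definition laguerreI (R : realType) (p : nat) (a0 : R) (c : 'I_p -> R)
    (i : 'I_p) (n : 'I_p -> nat) : {poly R} :=
  if n i == 0%N then 0 else
  ((-1) ^+ (n i - 1)%N * c i `^ (a0 + (msize n)%:R)
   * pochhammer (a0 + (msize n)%:R - (n i)%:R + 1) (n i - 1)
   / ((n i - 1)`!%:R * Gamma (a0 + (msize n)%:R))
   * \prod_(q < p | q != i) (c q / (c q - c i)) ^+ n q) *: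
  \sum_(l : {ffun 'I_p -> 'I_(n i)} | (\sum_(q < p) l q <= n i - 1)%N)
    (pochhammer (- (n i)%:R + 1) (\sum_(q < p) l q)%N
     / pochhammer (a0 + (msize n)%:R - (n i)%:R + 1) (\sum_(q < p) l q)%N
     * (c i ^+ (\sum_(q < p) l q)%N / (l i)`!%:R)
     * \prod_(q < p | q != i)
         (pochhammer (n q)%:R (l q) / ((l q)`!%:R * (c i - c q) ^+ l q)))
    *: 'X^(l i).

Definition stepline (p : nat) (n : nat) : 'I_p -> nat :=
  fun i => (n %/ p + (i < n %% p))%N.
Arguments stepline : clear implicits.

Lemma steplineE (p m k : nat) (i : 'I_p) : (k < p)%N ->
  stepline p (p * m + k) i = if (i < k)%N then m.+1 else m.
Proof.
move=> kp; have p_gt0 := leq_ltn_trans (leq0n k) kp.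
rewrite /stepline mulnC divnMDl // modnMDl divn_small // modn_small // addn0.
by case: (i < k)%N; rewrite ?addn1 ?addn0.
Qed.

Definition laguerreB (R : realType) (p : nat) (a0 : R) (c : 'I_p -> R)
    (n : nat) : {poly R} := laguerreII a0 c (stepline p n).

Definition laguerreA (R : realType) (p : nat) (a0 : R) (c : 'I_p -> R)
    (i : 'I_p) (n : nat) : {poly R} := laguerreI a0 c i (stepline p n).

(* b^j_{pm+k}.  With the index shift, 1 <= i <= r reads i < r and
   r <= i <= p reads r - 1 <= i; in particular c_{k+1} is [c k]. *)
Definition rec_coef_mk (R : realType) (p : nat) (a0 : R) (c : 'I_p -> R)
    (j m : nat) (k : 'I_p) : R :=
  if j == 0%N then
    (a0 + (p * m + k)%:R + 1) / c k
    + \sum_(i < p | (i < k)%N) m.+1%:R / c i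
    + \sum_(i < p | (k <= i)%N) m%:R / c i
  else if (j <= k)%N then
    (-1) ^+ j.+1 * pochhammer (a0 + (p * m + k)%:R - j%:R + 1) j *
    (\sum_(i < p | (i < k.+1 - j)%N) (m.+1%:R / c i ^+ j.+1 *
       \prod_(q < p | (k.+1 - j <= q < k)%N) ((c i - c q) / c q))
     + \sum_(i < p | (k <= i)%N) (m%:R / c i ^+ j.+1 *
       \prod_(q < p | (k.+1 - j <= q < k)%N) ((c i - c q) / c q)))
  else
    (-1) ^+ j.+1 * pochhammer (a0 + (p * m + k)%:R - j%:R + 1) j *
    \sum_(i < p | (k <= i < p + k.+1 - j)%N) (m%:R / c i ^+ j.+1 *
      \prod_(q < p | (q < k)%N) ((c i - c q) / c q) *
      \prod_(q < p | (p + k.+1 - j <= q)%N) ((c i - c q) / c q)).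

Definition rec_coef (R : realType) (p : nat) (hp : (0 < p)%N) (a0 : R)
    (c : 'I_p -> R) (j n : nat) : R :=
  rec_coef_mk a0 c j (n %/ p) (Ordinal (ltn_pmod n hp)).

Lemma rec_coefE (R : realType) (p : nat) (hp : (0 < p)%N) (a0 : R)
    (c : 'I_p -> R) (j m : nat) (k : 'I_p) :
  rec_coef hp a0 c j (p * m + k) = rec_coef_mk a0 c j m k.
Proof.
rewrite /rec_coef; congr rec_coef_mk.
  by rewrite mulnC divnMDl // divn_small // addn0.
by apply: val_inj; rewrite /= mulnC modnMDl modn_small.
Qed.

(* Main.v *)
Require Import Defs.
From HB Require Import structures.
From mathcomp Require Import all_boot all_order all_algebra.
From mathcomp Require Import all_classical all_reals all_analysis.
From mathcomp Require Import measurable_realfun.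
From mathcomp Require Import ring lra zify.
Set Implicit Arguments.
Unset Strict Implicit.
Unset Printing Implicit Defensive.
Import Order.TTheory GRing.Theory Num.Theory.
Import numFieldNormedType.Exports.
Local Open Scope ring_scope.

(** Write d_q = 1 / c_q, let e_r be d_q with q the residue of r modulo p,
    and put P_n(t) = (t - e_0) ... (t - e_(n-1)), which is the product of the
    (t - d_q)^(n_q) over the multi-index of step n.  Both families are
    transforms of P_n under which multiplication by x becomes a first order
    differential operator in t.

    Type II.  The coefficient of x^k in B_n is (a0+1)_n / (a0+1)_k times that
    of t^k in P_n ([coef_laguerreB]), because each factor of the multiple sum
    is the binomial expansion of a power of t - d_q.  Multiplication by x on
    x^k / (a0+1)_k corresponds to the operator (a0+1) t + t^2 d/dt.

    Type I.  A_n is -1 / Gamma(a0+n) times the residue at s = c_i of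
    exp(-(s-c_i)x) s^(a0-1) / P_n(1/s) ([laguerreA_typeI]); expanding the
    exponential, the power of s and the factors (c_q - s)^(-n_q) in powers of
    u = s - c_i gives the multiple sum.  Since residues of derivatives vanish,
    multiplication by x corresponds to d/ds, which is -t^2 d/dt for t = 1/s
    ([pole_residue_deriv], [typeI_deriv]).

    In both cases t^2 P_n'/P_n appears, and as
    t^2 / (t-d) = t + d + d^2 / (t-d), it equals
    n t + sum_q n_q d_q + sum_q n_q d_q^2 / (t - d_q).
    The first two terms, with the multiple of t coming from the power of x or
    s, give the neighbouring polynomial and b^0.  In the third one,
    1 / (t - d_q) is expanded in the Newton basis
    1 / ((t - f_1) ... (t - f_j)), where f_1, f_2, ... are the nodes met when
    walking along the step line, backwards for type II ([conodal_newton]) and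
    forwards for type I ([typeI_newton]):
    1 / (t - d) = sum_j (d-f_1)...(d-f_(j-1)) / ((t-f_1)...(t-f_j)).
    The expansion stops at j = p at the latest, since p consecutive nodes
    contain d_q.  Up to the Pochhammer factor, the resulting coefficients are
    the b^j ([rec_coef_newton]), and this factor is absorbed by (a0+1)_n for
    type II and, through Gamma(z+1) = z Gamma(z) ([GammaS]), by Gamma(a0+n)
    for type I. *)

(** * The functional equation of the Gamma integral *)

Section Gamma.
Variable R : realType.
Local Open Scope classical_set_scope.
Local Notation mu := (@lebesgue_measure R).

Definition gamma_integrand (y t : R) : R := t `^ y * expR (- t).

(** Compact segments exhausting the open half line; the bounds n+2 and 1/(n+2)
    keep every segment nondegenerate, as integration by parts requires. *)
Definition gamma_segment (n : nat) : set R := `[n.+2%:R^-1, n.+2%:R].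

Lemma powR_continuous_pos (y t : R) : 0 < t -> {for t, continuous (fun s => s `^ y)}.
Proof.
move=> t0; apply/differentiable_continuous/derivable1_diffP/derivable_powR.
by rewrite in_itv /= t0.
Qed.

Lemma expRN_continuous (t : R) : {for t, continuous (fun s : R => expR (- s))}.
Proof.
apply: (@continuous_comp _ _ _ (fun s : R => - s)).
  exact: continuousN.
exact: continuous_expR.
Qed.

Lemma gamma_integrand_continuous (y t : R) : 0 < t -> {for t, continuous (gamma_integrand y)}.
Proof.
move=> t0; apply: continuousM; first exact: powR_continuous_pos.
exact: expRN_continuous.
Qed.

Lemma gamma_segment_gt0 (n : nat) (t : R) : gamma_segment n t -> 0 < t.
Proof.
by rewrite /gamma_segment /= in_itv /= => /andP[h _]; apply: lt_le_trans h; rewrite invr_gt0.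
Qed.

Lemma bigcup_gamma_segment : \bigcup_n gamma_segment n = `]0, +oo[.
Proof.
apply/seteqP; split => [t [n _ /gamma_segment_gt0 t0]|t].
  by rewrite /= in_itv /= t0.
rewrite /= in_itv /= andbT => t0.
pose n := maxn (Num.truncn t) (Num.truncn t^-1).
exists n => //; rewrite /gamma_segment /= in_itv /=; apply/andP; split.
  rewrite -[leRHS]invrK lef_pV2 ?posrE ?invr_gt0 ?ltr0n //.
  apply: le_trans (ltW (truncnS_gt _)) _.
  by rewrite ler_nat /n; apply: leq_trans (leqnSn _); rewrite ltnS leq_maxr.
apply: le_trans (ltW (truncnS_gt _)) _.
by rewrite ler_nat /n; apply: leq_trans (leqnSn _); rewrite ltnS leq_maxl.
Qed.

Lemma measurable_gamma_integrand y n : measurable_fun (gamma_segment n) (gamma_integrand y).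
Proof.
have h : {within gamma_segment n, continuous (gamma_integrand y)}.
  apply: continuous_in_subspaceT => t; rewrite inE => /gamma_segment_gt0 t0.
  exact: gamma_integrand_continuous.
apply: subspace_continuous_measurable_fun => //.
exact: measurable_itv.
Qed.

(** Monotone convergence along the exhaustion by segments. *)
Lemma cvg_gamma_segment_integral y :
  (\int[mu]_(t in gamma_segment n) (gamma_integrand y t)%:E)%E @[n --> \oo] -->
  (\int[mu]_(t in `]0%R, +oo[) (gamma_integrand y t)%:E)%E.
Proof.
rewrite -bigcup_gamma_segment.
apply: ge0_nondecreasing_set_cvg_integral.
- move=> m n mn; apply/subsetPset => t; rewrite /gamma_segment /= !in_itv /= => /andP[h1 h2].
  have mn2 : (m.+2%:R <= n.+2%:R :> R) by rewrite ler_nat !ltnS.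
  by rewrite (le_trans h2 mn2) (le_trans _ h1) // lef_pV2 ?posrE ?ltr0n.
- by move=> n; exact: measurable_itv.
- by move=> n; apply/measurable_EFinP; exact: measurable_gamma_integrand.
- by move=> n t _; rewrite lee_fin mulr_ge0 ?powR_ge0 ?expR_ge0.
Qed.

Lemma cvg_gamma_integrand_0 x : 0 < x -> gamma_integrand x n.+2%:R^-1 @[n --> \oo] --> (0 : R).
Proof.
move=> x0.
have h : (n.+2%:R^-1 : R) `^ x @[n --> \oo] --> (0 : R).
  have hp : (fun n => n.+2%:R^-1 : R) @ \oo --> (0 : R)^'+.
    move=> A [e /= e0 hA].
    have hh : (fun n => harmonic n.+1 : R) @ \oo --> (0 : R).
      by rewrite (cvg_shiftS (@harmonic R)); exact: cvg_harmonic.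
    move/cvgrPdist_lt : hh => /(_ e e0); apply: filterS => n /= hn.
    by apply: hA; rewrite //= invr_gt0.
  exact: (cvg_comp _ _ hp (powR_cvg0 x0)).
apply: (@squeeze_cvgr _ _ _ _ (fun=> 0) (fun n => (n.+2%:R^-1 : R) `^ x)) => //; last exact: cvg_cst.
near=> n; rewrite /gamma_integrand mulr_ge0 ?powR_ge0 ?expR_ge0 //=.
by rewrite ler_piMr ?powR_ge0 // expR_le1 oppr_le0 invr_ge0.
Unshelve. all: by end_near. Qed.

(** The exponential beats any power: exp t >= t^(k+2) / (k+2)! with k + 1 > x
    leaves a factor 1/t. *)
Lemma cvg_gamma_integrand_y x : gamma_integrand x n.+2%:R @[n --> \oo] --> (0 : R).
Proof.
pose k := Num.truncn x.
apply: (@squeeze_cvgr _ _ _ _ (fun=> 0) (fun n => (k.+2)`!%:R * harmonic n.+1)).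
- near=> n; rewrite /gamma_integrand mulr_ge0 ?powR_ge0 ?expR_ge0 //=.
  have n0 : 0 < n.+2%:R :> R by rewrite ltr0n.
  have h1 : n.+2%:R `^ x <= n.+2%:R ^+ k.+1 :> R.
    rewrite -powR_mulrn ?ler0n // ler_powR ?ler1n //.
    exact/ltW/truncnS_gt.
  rewrite expRN ler_pdivrMr ?expR_gt0 //.
  apply: le_trans h1 _.
  rewrite /harmonic /= mulrAC ler_pdivlMr // -exprSr mulrC.
  have h2 := @expR_ge1Dxn R n.+2%:R k.+1 (ler0n _ _).
  rewrite -ler_pdivrMr ?ltr0n ?fact_gt0 //.
  by apply: le_trans h2; rewrite lerDr.
- exact: cvg_cst.
- rewrite -(mulr0 (k.+2)`!%:R); apply: cvgMr.
  by rewrite (cvg_shiftS (@harmonic R)); exact: cvg_harmonic.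
Unshelve. all: by end_near. Qed.

(** Both sides are finite here, so the boundary terms can be split off; they
    vanish in the limit, which gives the functional equation. *)
Lemma gamma_segment_by_parts x n :
  (\int[mu]_(t in gamma_segment n) (gamma_integrand x t)%:E =
   (gamma_integrand x n.+2%:R^-1 - gamma_integrand x n.+2%:R)%:E
   + x%:E * \int[mu]_(t in gamma_segment n) (gamma_integrand (x - 1) t)%:E)%E.
Proof.
have n0 : 0 < n.+2%:R :> R by rewrite ltr0n.
have ab : n.+2%:R^-1 < n.+2%:R :> R.
  by rewrite (@lt_trans _ _ 1) ?invf_lt1 ?ltr1n.
have a0 : 0 < n.+2%:R^-1 :> R by rewrite invr_gt0.
pose F (t : R) := t `^ x; pose f t : R := x * t `^ (x - 1).
pose G (t : R) := - expR (- t); pose g (t : R) := expR (- t).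
have dG t : is_derive t (1 : R) G (g t).
  rewrite /G /g.
  have h : is_derive t (1 : R) (expR \o -%R) (expR (- t) * -1).
    exact: is_derive1_comp.
  by have := is_deriveN h; rewrite mulrN1 opprK.
have cG t : {for t, continuous G} by apply: continuousN; exact: expRN_continuous.
have -> : (\int[mu]_(t in gamma_segment n) (gamma_integrand x t)%:E =
           \int[mu]_(t in gamma_segment n) (F t * g t)%:E)%E by [].
have dF' (t : R) : 0 < t -> is_derive t (1 : R) F (f t) by move=> t0; exact: is_derive1_powR.
have cF (t : R) : 0 < t -> {for t, continuous F} by exact: powR_continuous_pos.
have pos (t : R) : t \in `]n.+2%:R^-1, n.+2%:R[%R -> 0 < t.
  by rewrite in_itv /= => /andP[h _]; exact: lt_trans h.
rewrite (@integration_by_parts _ F G f g) //.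
- have -> : F n.+2%:R * G n.+2%:R - F n.+2%:R^-1 * G n.+2%:R^-1 =
            gamma_integrand x n.+2%:R^-1 - gamma_integrand x n.+2%:R.
    by rewrite /F /G /gamma_integrand; ring.
  congr (_ + _)%E.
  have -> : (\int[mu]_(t in gamma_segment n) (f t * G t)%:E =
             (- x)%:E * \int[mu]_(t in gamma_segment n) (gamma_integrand (x - 1) t)%:E)%E.
    have -> : (fun t => (f t * G t)%:E) = (fun t => (- x)%:E * (gamma_integrand (x - 1) t)%:E)%E.
      by apply/funext => t; rewrite -EFinM /f /G /gamma_integrand; congr EFin; ring.
    rewrite integralZl //; first exact: measurable_itv.
    apply: continuous_compact_integrable; first exact: segment_compact.
    apply: continuous_in_subspaceT => t; rewrite inE => /gamma_segment_gt0 t0.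
    exact: gamma_integrand_continuous.
  by rewrite EFinN mulNe oppeK.
- apply: continuous_in_subspaceT => t; rewrite inE => /gamma_segment_gt0 t0.
  apply: cvgMr; exact: powR_continuous_pos.
- split.
  + by move=> t /pos /dF'[].
  + exact/cvg_at_right_filter/cF.
  + exact/cvg_at_left_filter/cF.
- by move=> t /pos /dF' ?; rewrite derive1E derive_val.
- apply: continuous_in_subspaceT => t _; exact: expRN_continuous.
- split.
  + by move=> t _; case: (dG t).
  + exact/cvg_at_right_filter/cG.
  + exact/cvg_at_left_filter/cG.
- by move=> t _; rewrite derive1E; have := dG t => h; rewrite derive_val.
Qed.

Lemma gamma_integralS x : 0 < x ->
  (\int[mu]_(t in `]0%R, +oo[) (gamma_integrand x t)%:E =
   x%:E * \int[mu]_(t in `]0%R, +oo[) (gamma_integrand (x - 1) t)%:E)%E.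
Proof.
move=> x0; rewrite -(cvg_lim (@ereal_hausdorff R) (@cvg_gamma_segment_integral x)).
apply: cvg_lim; first exact: ereal_hausdorff.
under eq_fun do rewrite gamma_segment_by_parts.
have h0 : (gamma_integrand x n.+2%:R^-1 - gamma_integrand x n.+2%:R)%:E @[n --> \oo] --> (0 : \bar R)%E.
  apply: cvg_EFin; first by near=> n.
  by rewrite -(subr0 (0 : R)); apply: cvgB; [exact: cvg_gamma_integrand_0|exact: cvg_gamma_integrand_y].
have h1 : (x%:E * \int[mu]_(t in gamma_segment n) (gamma_integrand (x - 1) t)%:E)%E @[n --> \oo] -->
          (x%:E * \int[mu]_(t in `]0%R, +oo[) (gamma_integrand (x - 1) t)%:E)%E.
  by apply: cvgeZl => //; exact: cvg_gamma_segment_integral.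
have h01 : ((0 : \bar R) +? x%:E * \int[mu]_(t in `]0%R, +oo[) (gamma_integrand (x - 1) t)%:E)%E.
  by [].
by have := cvgeD h01 h0 h1; rewrite add0e; apply.
Unshelve. all: by end_near. Qed.

(** The extended real integrals satisfy the equation whether or not they are
    finite, and multiplication by a finite x > 0 commutes with [fine]. *)
Lemma GammaS (x : R) : 0 < x -> Gamma (x + 1) = x * Gamma x.
Proof.
move=> x0.
have GE (y : R) : Gamma y = fine (\int[mu]_(t in `]0%R, +oo[) (gamma_integrand (y - 1) t)%:E)%E.
  rewrite /Gamma /Rintegral; congr fine.
  rewrite integral_itv_obnd_cbnd //.
  rewrite -bigcup_gamma_segment; apply/measurable_EFinP.
  apply/measurable_fun_bigcup => n; first exact: measurable_itv.
  exact: measurable_gamma_integrand.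
rewrite !GE addrK gamma_integralS //.
case: (integral _ _ _) => [r | | ] //=.
- by rewrite gt0_muley ?lte_fin //= mulr0.
- by rewrite gt0_muleNy ?lte_fin //= mulr0.
Qed.

End Gamma.

(** * The step line and the recurrence coefficients *)

Section StepLine.
Variables (p : nat) (hp : (0 < p)%N).

(** The step from multi-index number r to number r+1 raises this entry. *)
Definition step_dir (r : nat) : 'I_p := Ordinal (ltn_pmod r hp).

Lemma step_dir_ord (i : 'I_p) : step_dir i = i.
Proof. by apply: val_inj; rewrite /= modn_small. Qed.

Lemma step_dirDl (m r : nat) : step_dir (p * m + r) = step_dir r.
Proof. by apply: val_inj; rewrite /= mulnC modnMDl. Qed.

Lemma stepline0 (i : 'I_p) : stepline p 0 i = 0%N.
Proof. by rewrite /stepline div0n mod0n. Qed.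

Lemma steplineS (n : nat) (i : 'I_p) :
  stepline p n.+1 i = (stepline p n i + (step_dir n == i))%N.
Proof.
have -> : (step_dir n == i) = (n %% p == i)%N by [].
rewrite {1 2}(divn_eq n p) mulnC; set m := (n %/ p)%N; set k := (n %% p)%N.
have kp : (k < p)%N by rewrite ltn_mod.
rewrite -addnS (steplineE m i kp); have [k1p|k1p] := ltnP k.+1 p.
  by rewrite (steplineE m i k1p) ltnS; case: ltngtP => //= _; rewrite ?addn0 ?addn1.
have -> : (p * m + k.+1)%N = (p * m.+1 + 0)%N by nia.
have ik := ltn_ord i; have ekp : k.+1 = p by lia.
by rewrite steplineE //=; case: ltngtP; lia.
Qed.

Lemma steplineDp (n : nat) (i : 'I_p) : stepline p (n + p) i = (stepline p n i).+1.
Proof. by rewrite /stepline divnDr // divnn hp modnDr addn1 addSn. Qed.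

Lemma msize_stepline (n : nat) : msize (stepline p n) = n.
Proof.
rewrite /msize; elim: n => [|n IHn].
  by rewrite big1 // => i _; rewrite stepline0.
under eq_bigr do rewrite steplineS.
rewrite big_split /= IHn (bigD1 (step_dir n)) //= eqxx big1 ?addn0 ?addn1 //.
by move=> i /negbTE; rewrite eq_sym => ->.
Qed.

Lemma stepline_nondecr (i : 'I_p) : {homo (fun n => stepline p n i) : m n / (m <= n)%N}.
Proof.
by apply: homo_leq => [n|m n k|n] //; [exact: leq_trans|rewrite steplineS leq_addr].
Qed.

Lemma stepline_lt_step (m n : nat) (i : 'I_p) :
  (stepline p m i < stepline p n i)%N ->
  exists2 r, (m <= r < n)%N & step_dir r = i.
Proof.
elim: n => [|n IHn]; first by rewrite stepline0.
have [mn lt|nm lt] := leqP m n; last first.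
  by have := stepline_nondecr i nm; rewrite leqNgt lt.
move: lt; rewrite steplineS; case: eqP => [ri _|_].
  by exists n; rewrite ?mn ?leqnn.
rewrite addn0 => /IHn[r /andP[mr rn] ri]; exists r => //.
by rewrite mr ltnS ltnW.
Qed.

Section Nodes.
Variables (R : realType) (c : 'I_p -> R).

Definition node (r : nat) : R := (c (step_dir r))^-1.

(** This vanishing ends every Newton expansion, and it discards the indices
    that the recurrence coefficients leave out of their sums. *)
Lemma node_prod_eq0 (m n : nat) (i : 'I_p) :
  (stepline p m i < stepline p n i)%N ->
  \prod_(m <= r < n) ((c i)^-1 - node r) = 0.
Proof.
move=> /stepline_lt_step[r /andP[mr rn] ri].
rewrite (big_cat_nat (n := r)) //=; last exact: ltnW.
by rewrite [X in _ * X]big_ltn // /node ri subrr mul0r mulr0.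
Qed.

(** The coefficient of 1 / ((t - e_(n-1)) ... (t - e_(n-j))) in the Newton
    expansion of sum_i n_i d_i^2 / (t - d_i). *)
Definition newton_coef (j n : nat) : R :=
  \sum_(i < p) (stepline p n i)%:R * (c i)^-1 ^+ 2 *
    \prod_(n.+1 - j <= r < n) ((c i)^-1 - node r).

Lemma prod_step_dir (F : 'I_p -> R) (P : pred nat) :
  \prod_(q < p | P q) F q = \prod_(0 <= q < p | P q) F (step_dir q).
Proof. by rewrite big_mkord; apply: eq_bigr => q _; rewrite step_dir_ord. Qed.

Lemma prod_shift_period (F : 'I_p -> R) (m a b : nat) :
  \prod_(p * m + a <= r < p * m + b) F (step_dir r) =
  \prod_(a <= r < b) F (step_dir r).
Proof.
rewrite -{1}[(p * m + a)%N]addnC big_addn addKn.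
by apply: eq_bigr => r _; rewrite addnC step_dirDl.
Qed.

Hypothesis c_neq0 : forall i, c i != 0.

(** Each factor is rewritten by 1/c_i - 1/c_q = - (1/c_i) (c_i - c_q) / c_q. *)
Lemma node_prod_ratio (i : 'I_p) (j n : nat) : (0 < j)%N -> (j <= n)%N ->
  (c i)^-1 ^+ 2 * \prod_(n.+1 - j <= r < n) ((c i)^-1 - node r) =
  (-1) ^+ j.+1 * ((c i) ^+ j.+1)^-1 *
  \prod_(n.+1 - j <= r < n) ((c i - c (step_dir r)) / c (step_dir r)).
Proof.
move=> j0 jn.
have -> : \prod_(n.+1 - j <= r < n) ((c i)^-1 - node r) =
  \prod_(n.+1 - j <= r < n) (- (c i)^-1 * ((c i - c (step_dir r)) / c (step_dir r))).
  apply: eq_bigr => r _; rewrite /node; field.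
  by rewrite !c_neq0.
rewrite big_split /= prodr_const_nat.
have -> : (n - (n.+1 - j) = j.-1)%N by lia.
case: j j0 jn => // j _ _; rewrite -exprVn (exprNn (c i)^-1) /= !exprS; ring.
Qed.

(** The last j - 1 steps before n = pm + k stay inside the current period when
    j <= k, and otherwise wrap around to the end of the previous one; these are
    the two cases in the definition of b^j.  The sum over i runs over all
    indices in [newton_coef], but an index among those of the product
    contributes zero, and each remaining one has the n_i written in the
    corresponding sum of b^j. *)
Lemma rec_coef_newton (a0 : R) (j n : nat) : (0 < j)%N -> (j <= p)%N -> (j <= n)%N ->
  rec_coef hp a0 c j n = pochhammer (a0 + n%:R - j%:R + 1) j * newton_coef j n.
Proof.
move=> j0 jp.
rewrite (divn_eq n p) mulnC -[(n %% p)%N]/(nat_of_ord (step_dir n)).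
move: (n %/ p)%N (step_dir n) => m k jn; have kp := ltn_ord k.
rewrite rec_coefE /rec_coef_mk gtn_eqF //.
have -> : newton_coef j (p * m + k) = (-1) ^+ j.+1 * \sum_(i < p)
   ((stepline p (p * m + k) i)%:R / c i ^+ j.+1 *
     \prod_((p * m + k).+1 - j <= r < p * m + k) ((c i - c (step_dir r)) / c (step_dir r))).
  rewrite mulr_sumr /newton_coef; apply: eq_bigr => i _.
  by rewrite -mulrA node_prod_ratio //; ring.
rewrite [RHS]mulrA [pochhammer _ _ * _]mulrC.
case: leqP => [jk|kj]; congr (_ * _).
- have prodE i : \prod_((p * m + k).+1 - j <= r < p * m + k)
      ((c i - c (step_dir r)) / c (step_dir r)) =
    \prod_(q < p | (k.+1 - j <= q < k)%N) ((c i - c q) / c q).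
    have -> : ((p * m + k).+1 - j = p * m + (k.+1 - j))%N by lia.
    rewrite (prod_shift_period (fun q => (c i - c q) / c q)).
    rewrite (prod_step_dir (fun q => (c i - c q) / c q) (fun q => k.+1 - j <= q < k)%N).
    rewrite (big_nat_widen _ _ _ _ _ (ltnW kp)) //=.
    rewrite (big_nat_widenl _ 0) //=; apply: eq_bigl => q; lia.
  rewrite [RHS](bigID (fun i : 'I_p => (i < k)%N)) /=; congr (_ + _).
    rewrite [RHS](bigID (fun i : 'I_p => (i < k.+1 - j)%N)) /= [X in _ = _ + X]big1 ?addr0.
      apply: eq_big => [i|i ik]; first by lia.
      rewrite prodE steplineE //. have -> : (i < k)%N by lia.
      by [].
    move=> i /andP[ik ij]; rewrite prodE (bigD1 i) /=; last by lia.
    by rewrite subrr mul0r mul0r mulr0.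
  apply: eq_big => [i|i ik]; first by rewrite -leqNgt.
  rewrite prodE steplineE //. rewrite ltnNge ik /=.
  by [].
(* j <= n and k < j exclude the first period, so a previous one exists *)
- have m0 : (0 < m)%N by case: (m) jn => //; lia.
  have prodE i : \prod_((p * m + k).+1 - j <= r < p * m + k)
      ((c i - c (step_dir r)) / c (step_dir r)) =
    \prod_(q < p | (q < k)%N) ((c i - c q) / c q) *
    \prod_(q < p | (p + k.+1 - j <= q)%N) ((c i - c q) / c q).
    rewrite (big_cat_nat (n := (p * m)%N)) /=; [|by lia|by lia].
    rewrite mulrC; congr (_ * _).
      rewrite -[X in \prod_(X <= _ < _) _]addn0.
      rewrite (prod_shift_period (fun q => (c i - c q) / c q)).
      rewrite (prod_step_dir (fun q => (c i - c q) / c q) (fun q => q < k)%N).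
      by rewrite (big_nat_widen _ _ _ _ _ (ltnW kp)) //=.
    have -> : ((p * m + k).+1 - j = p * m.-1 + (p + k.+1 - j))%N by nia.
    have -> : (p * m = p * m.-1 + p)%N by nia.
    rewrite (prod_shift_period (fun q => (c i - c q) / c q)).
    rewrite (prod_step_dir (fun q => (c i - c q) / c q) (fun q => p + k.+1 - j <= q)%N).
    by rewrite (big_nat_widenl _ 0) //=; apply: eq_bigl => q; lia.
  rewrite [RHS](bigID (fun i : 'I_p => (k <= i < p + k.+1 - j)%N)) /=.
  rewrite [X in _ = _ + X]big1 ?addr0.
    apply: eq_big => [i|i /andP[ik _]]; first by lia.
    by rewrite prodE steplineE // ltnNge ik /= mulrA.
  move=> i ij; rewrite prodE.
  have [ik|ki] := ltnP i k.
    by rewrite [\prod_(q < p | (q < k)%N) _](bigD1 i) //= subrr !mul0r mulr0.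
  rewrite [\prod_(q < p | (_ <= q)%N) _](bigD1 i) /=; last by lia.
  by rewrite subrr !mul0r !mulr0.
Qed.

End Nodes.
End StepLine.

(** * Pochhammer symbols *)

Section Pochhammer.
Variable R : realType.

Lemma pochhammer0 (x : R) : pochhammer x 0 = 1.
Proof. by rewrite /pochhammer big_ord0. Qed.

Lemma pochhammerS (x : R) n : pochhammer x n.+1 = pochhammer x n * (x + n%:R).
Proof. by rewrite /pochhammer big_ord_recr. Qed.

Lemma pochhammerD (x : R) m n :
  pochhammer x (m + n) = pochhammer x m * pochhammer (x + m%:R) n.
Proof.
elim: n => [|n IHn]; first by rewrite addn0 pochhammer0 mulr1.
by rewrite addnS !pochhammerS IHn natrD; ring.
Qed.

Lemma pochhammer_gt0 (x : R) n : 0 < x -> 0 < pochhammer x n.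
Proof. by move=> x0; apply: prodr_gt0 => i _; rewrite ltr_wpDr. Qed.

Lemma pochhammer_neg n l : pochhammer (- n%:R : R) l = (-1) ^+ l * (n ^_ l)%:R.
Proof.
elim: l => [|l IHl]; first by rewrite pochhammer0 mul1r.
rewrite pochhammerS IHl ffactnSr natrM exprS.
have [ln|nl] := leqP l n; first by rewrite natrB //; ring.
by rewrite ffact_small // !mul0r !mulr0 !mul0r.
Qed.

Lemma GammaD (x : R) n : 0 < x -> Gamma (x + n%:R) = pochhammer x n * Gamma x.
Proof.
move=> x0; elim: n => [|n IHn]; first by rewrite addr0 pochhammer0 mul1r.
rewrite -natr1 addrA GammaS; last by rewrite ltr_wpDr.
by rewrite IHn pochhammerS; ring.
Qed.

End Pochhammer.

(** * Type II polynomials *)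

Section TypeII.
Variables (R : realType) (p : nat) (a0 : R).
Hypothesis ha0 : -1 < a0.

Lemma pochhammer_neq0 n : pochhammer (a0 + 1) n != 0.
Proof. by rewrite gt_eqF // pochhammer_gt0 // -ltrBlDr sub0r. Qed.

(** The binomial theorem in Pochhammer form, summed over a range M that can be
    common to all the factors of a product. *)
Lemma subX_expansion (x : R) (n M : nat) : x != 0 -> (n <= M)%N ->
  ('X - (x^-1)%:P) ^+ n = \sum_(l < M.+1 | (l <= n)%N)
    ((-1) ^+ n * (pochhammer (- n%:R) l * x ^ (l%:Z - n%:Z) / l`!%:R)) *: 'X^l.
Proof.
move=> x0 nM; rewrite addrC -polyCN exprDn.
rewrite (big_ord_widen M.+1 (fun i => (- x^-1)%:P ^+ (n - i) * 'X ^+ i *+ 'C(n, i))) //.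
apply: eq_big => [l|l]; rewrite ltnS // => ln.
rewrite -mul_polyC -polyC_exp -mulrnAl -polyCMn; congr (_%:P * _).
rewrite pochhammer_neg -bin_ffact natrM (exprNn x^-1).
have -> : (l%:Z - n%:Z = - (n - l)%N%:Z) by rewrite -subzn //; ring.
rewrite -exprnN -exprVn.
have -> : (-1) ^+ n = (-1) ^+ (n - l) * (-1) ^+ l :> R.
  by rewrite -exprD subnK.
have fl : l`!%:R != 0 :> R by rewrite pnatr_eq0 -lt0n fact_gt0.
rewrite -[LHS]mulr_natr; set s := (-1) ^+ l.
have s2 : s * s = 1 by rewrite -expr2 sqrr_sign.
rewrite [RHS](_ : _ = (s * s) * ((-1) ^+ (n - l) * x^-1 ^+ (n - l) * 'C(n, l)%:R)).
  by rewrite s2 mul1r.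
by field.
Qed.

(** Only the factor 1 / (a0+1)_(l_1+...+l_p) couples the summation indices of a
    type II polynomial, and it depends on the exponent of x alone; without it
    the sum is a product of binomial expansions. *)
Lemma coef_laguerreII (c : 'I_p -> R) (nu : 'I_p -> nat) k :
  (forall i, c i != 0) ->
  (laguerreII a0 c nu)`_k =
  pochhammer (a0 + 1) (msize nu) / pochhammer (a0 + 1) k *
  (\prod_(q < p) ('X - ((c q)^-1)%:P) ^+ nu q)`_k.
Proof.
move=> c0; set M := msize nu.
have nuM q : (nu q <= M)%N by rewrite /M /msize (bigD1 q) //= leq_addr.
under [in RHS]eq_bigr => q _ do rewrite (subX_expansion (c0 q) (nuM q)).
rewrite bigA_distr_big_dep /=.
rewrite /laguerreII -/M coefZ !coef_sum !mulr_sumr; apply: eq_bigr => l _.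
have -> : \prod_(q < p) (((-1) ^+ nu q * (pochhammer (- (nu q)%:R) (l q) *
    c q ^ ((l q)%:Z - (nu q)%:Z) / (l q)`!%:R)) *: 'X^(l q)) =
  ((-1) ^+ M * \prod_(q < p) (pochhammer (- (nu q)%:R) (l q) *
    c q ^ ((l q)%:Z - (nu q)%:Z) / (l q)`!%:R)) *: 'X^(\sum_(q < p) l q) :> {poly R}.
  by rewrite scaler_prod big_split /= !expr_sum.
rewrite !coefZ coefXn; case: eqP => [->|_]; last by rewrite !mulr0.
by rewrite !mulr1; ring.
Qed.

End TypeII.

Section TypeIIRecurrence.
Variables (R : realType) (p : nat) (hp : (0 < p)%N) (c : 'I_p -> R).
Hypothesis c_neq0 : forall i, c i != 0.
Local Notation node := (node hp c).
Local Notation newton_coef := (newton_coef hp c).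

Definition nodal (n : nat) : {poly R} := \prod_(0 <= r < n) ('X - (node r)%:P).
(** The quotient P_n / (t - d_a), exact once the entry a of step n is
    positive. *)
Definition conodal (a : 'I_p) (n : nat) : {poly R} :=
  nodal n %/ ('X - ((c a)^-1)%:P).

Lemma stepline_prod (T : comRingType) (F : 'I_p -> T) (n : nat) :
  \prod_(q < p) F q ^+ stepline p n q = \prod_(0 <= r < n) F (step_dir hp r).
Proof.
elim: n => [|n IHn].
  by rewrite big_nil big1 // => q _; rewrite stepline0.
rewrite big_nat_recr //= -IHn (bigD1 (step_dir hp n)) //=.
rewrite [in RHS](bigD1 (step_dir hp n)) //= steplineS eqxx addn1 exprS.
rewrite [RHS]mulrC [RHS]mulrA; congr (_ * _).
by apply: eq_bigr => q /negbTE; rewrite (steplineS hp) eq_sym => ->; rewrite addn0.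
Qed.

Lemma nodalS n : nodal n.+1 = nodal n * ('X - (node n)%:P).
Proof. by rewrite /nodal big_nat_recr. Qed.

Lemma conodalK a n : (0 < stepline p n a)%N ->
  conodal a n * ('X - ((c a)^-1)%:P) = nodal n.
Proof.
move=> na; apply/divpK; rewrite dvdp_XsubCl /root /nodal horner_prod.
under eq_bigr do rewrite hornerXsubC.
by rewrite node_prod_eq0 // stepline0.
Qed.

Lemma conodalP a n q : nodal n = q * ('X - ((c a)^-1)%:P) -> conodal a n = q.
Proof. by rewrite /conodal => ->; rewrite mulpK ?polyXsubC_eq0. Qed.

Lemma conodalS a n : (0 < stepline p n a)%N ->
  conodal a n.+1 = conodal a n * ('X - (node n)%:P).
Proof. by move=> na; apply: conodalP; rewrite nodalS -(conodalK na) mulrAC. Qed.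

Lemma conodal_step_dir n : conodal (step_dir hp n) n.+1 = nodal n.
Proof. by apply: conodalP; rewrite nodalS. Qed.

(** Divided by P_(n+1), this is the elementary step
    1/(t-d) = 1/(t-e) + (d-e) / ((t-e)(t-d)) of the Newton expansion, with
    e = e_n.  If the entry a of step n is zero then a was raised by the last
    step, so that the coefficient d - e of the inexact quotient is zero. *)
Lemma conodal_step a n : (0 < stepline p n.+1 a)%N ->
  conodal a n.+1 = nodal n + ((c a)^-1 - node n) *: conodal a n.
Proof.
have [na _|] := ltnP 0 (stepline p n a).
  rewrite conodalS // -(conodalK na) -mul_polyC polyCB; ring.
rewrite leqn0 (steplineS hp) => /eqP ->; case: eqP => // <- _.
by rewrite conodal_step_dir subrr scale0r addr0.
Qed.

(** J steps of the Newton expansion.  Once the quotient in the remainder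
    becomes inexact, its coefficient has vanished, and so have all later
    ones. *)
Lemma conodal_partial a n J : (0 < stepline p n a)%N -> (J <= n)%N ->
  conodal a n =
  \sum_(1 <= j < J.+1)
     \prod_(n.+1 - j <= r < n) ((c a)^-1 - node r) *: nodal (n - j)
  + \prod_(n - J <= r < n) ((c a)^-1 - node r) *: conodal a (n - J).
Proof.
move=> na; elim: J => [|J IHJ] Jn.
  by rewrite [X in _ = X + _]big_geq // add0r subn0 big_geq // scale1r.
rewrite (IHJ (ltnW Jn)) [in RHS]big_nat_recr //= -addrA; congr (_ + _).
rewrite subSS.
have E : (n - J = (n - J.+1).+1)%N by lia.
rewrite [X in _ = _ + X *: _](big_ltn (m := (n - J.+1)%N)); last by lia.
rewrite -E; have [nJ|] := ltnP 0 (stepline p (n - J) a).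
  rewrite [in conodal a (n - J)]E conodal_step -?E // scalerDr scalerA.
  by rewrite [_ * (_ - _)]mulrC.
rewrite leqn0 => /eqP nJ.
by rewrite node_prod_eq0 ?nJ // mulr0 !scale0r addr0.
Qed.

(** With J = p, or J = n if n < p, the nodes used include d_a, which kills the
    remainder. *)
Lemma conodal_newton a n : (0 < stepline p n a)%N ->
  conodal a n =
  \sum_(1 <= j < p.+1) \prod_(n.+1 - j <= r < n) ((c a)^-1 - node r) *:
     (if (j <= n)%N then nodal (n - j) else 0).
Proof.
move=> na; have [pn|np] := leqP p n.
  rewrite (conodal_partial na pn) node_prod_eq0 ?scale0r ?addr0.
    by rewrite !big_nat; apply: eq_bigr => j j_p; rewrite ifT //; lia.
  by rewrite -[in X in (_ < X)%N](subnK pn) steplineDp.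
rewrite (conodal_partial na (leqnn n)) subnn node_prod_eq0 ?stepline0 //.
rewrite scale0r addr0 [RHS](big_cat_nat (n := n.+1)) //=; last by lia.
rewrite [X in _ = _ + X]big_nat [X in _ = _ + X]big1 ?addr0.
  by rewrite !big_nat; apply: eq_bigr => j j_n; rewrite ifT //; lia.
by move=> j j_n; rewrite ifF ?scaler0 //; lia.
Qed.

(** The logarithmic derivative of P_n. *)
Lemma deriv_nodal n :
  (nodal n)^`() = \sum_(a < p) (stepline p n a)%:R *: conodal a n.
Proof.
elim: n => [|n IHn].
  rewrite /nodal big_nil derivC big1 // => a _.
  by rewrite stepline0 scale0r.
rewrite nodalS derivM IHn derivXsubC mulr1.
transitivity (\sum_(a < p) ((stepline p n a)%:R *: conodal a n.+1 +
                (step_dir hp n == a)%:R *: conodal a n.+1)).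
  rewrite big_split /=; congr (_ + _).
    rewrite mulr_suml; apply: eq_bigr => a _; have [->|na] := posnP (stepline p n a).
      by rewrite !scale0r mul0r.
    by rewrite conodalS // scalerAl.
  rewrite (bigD1 (step_dir hp n)) //= eqxx scale1r conodal_step_dir big1 ?addr0 //.
  by move=> a /negbTE; rewrite eq_sym => ->; rewrite scale0r.
by apply: eq_bigr => a _; rewrite -scalerDl -natrD -steplineS.
Qed.

Lemma rec_coef0 (a0 : R) n :
  rec_coef hp a0 c 0 n =
  (a0 + n%:R + 1) * node n + \sum_(i < p) (stepline p n i)%:R * (c i)^-1.
Proof.
rewrite /node (divn_eq n p) mulnC -[(n %% p)%N]/(nat_of_ord (step_dir hp n)).
move: (n %/ p)%N (step_dir hp n) => m k; rewrite rec_coefE /rec_coef_mk eqxx.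
rewrite step_dirDl step_dir_ord -addrA; congr (_ + _).
rewrite [RHS](bigID (fun i : 'I_p => (i < k)%N)) /=; congr (_ + _).
  by apply: eq_bigr => i ik; rewrite steplineE // ik.
apply: eq_big => [i|i ki]; first by rewrite -leqNgt.
by rewrite steplineE // ltnNge ki.
Qed.

Lemma sum_stepline n : \sum_(a < p) (stepline p n a)%:R = n%:R :> R.
Proof. by rewrite -natr_sum -/(msize _) msize_stepline. Qed.

(** The type II recurrence before the transform to the variable x: the identity
    t^2 = (t + d)(t - d) + d^2 is applied in each term of t^2 P_n'. *)
Lemma nodal_recurrence (a0 : R) n :
  (a0 + 1) *: ('X * nodal n) + 'X ^+ 2 * (nodal n)^`() =
  (a0 + 1 + n%:R) *: nodal n.+1 + rec_coef hp a0 c 0 n *: nodal n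
  + \sum_(1 <= j < p.+1) newton_coef j n *:
      (if (j <= n)%N then nodal (n - j) else 0).
Proof.
have -> : 'X ^+ 2 * (nodal n)^`() =
    (n%:R *: 'X + (\sum_(i < p) (stepline p n i)%:R * (c i)^-1)%:P) * nodal n
    + \sum_(a < p) ((stepline p n a)%:R * (c a)^-1 ^+ 2) *: conodal a n.
  rewrite deriv_nodal -[in n%:R *: 'X]sum_stepline scaler_suml rmorph_sum /=.
  rewrite -big_split /= mulr_suml mulr_sumr -big_split; apply: eq_bigr => a _ /=.
  have [->|na] := posnP (stepline p n a).
    by rewrite !(mul0r, scale0r, mulr0, addr0).
  by rewrite -(conodalK na) -!mul_polyC !polyCM ?polyC_exp; ring.
have -> : \sum_(a < p) ((stepline p n a)%:R * (c a)^-1 ^+ 2) *: conodal a n =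
  \sum_(1 <= j < p.+1) newton_coef j n *: (if (j <= n)%N then nodal (n - j) else 0).
  under [RHS]eq_bigr do rewrite scaler_suml.
  rewrite exchange_big /=; apply: eq_bigr => a _.
  have [->|na] := posnP (stepline p n a).
    by rewrite mul0r scale0r big1 // => j _; rewrite !mul0r scale0r.
  rewrite {1}(conodal_newton na) scaler_sumr; apply: eq_bigr => j _.
  by rewrite scalerA.
rewrite addrA; congr (_ + _).
by rewrite nodalS rec_coef0 -!mul_polyC !(polyCM, polyCD); ring.
Qed.

Lemma coef_laguerreB (a0 : R) n k : -1 < a0 ->
  (laguerreB a0 c n)`_k =
  pochhammer (a0 + 1) n / pochhammer (a0 + 1) k * (nodal n)`_k.
Proof.
move=> ha0; rewrite /laguerreB coef_laguerreII // msize_stepline //.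
by rewrite (stepline_prod (fun q => 'X - ((c q)^-1)%:P)).
Qed.

Lemma laguerreB_recurrence (a0 : R) n : -1 < a0 ->
  'X * laguerreB a0 c n =
  laguerreB a0 c n.+1 + rec_coef hp a0 c 0 n *: laguerreB a0 c n
  + \sum_(1 <= j < p.+1)
      rec_coef hp a0 c j n *:
        (if (j <= n)%N then laguerreB a0 c (n - j) else 0).
Proof.
move=> ha0; apply/polyP => k.
transitivity (pochhammer (a0 + 1) n / pochhammer (a0 + 1) k *
  ((a0 + 1) *: ('X * nodal n) + 'X ^+ 2 * (nodal n)^`())`_k).
  rewrite [in RHS]coefD [in RHS]coefZ expr2 -(mulrA 'X 'X) !coefXM.
  case: k => [|k] /=; first by rewrite !(mulr0, addr0).
  rewrite coef_laguerreB //; have pk := pochhammer_neq0 ha0 k.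
  have : pochhammer (a0 + 1) k.+1 != 0 := pochhammer_neq0 ha0 k.+1.
  rewrite pochhammerS mulf_eq0 negb_or => /andP[_ ak].
  case: k pk ak => [|k] pk ak /=; first by rewrite addr0 in ak *; field; rewrite pk ak.
  rewrite coef_deriv -[in RHS]mulr_natr; move: ak; set k1 := k.+1%:R => ak.
  by field; rewrite nat1r ak pk.
(* the polynomials are abstracted to keep coefficient lemmas from unfolding
   them *)
have := fun m => coef_laguerreB m k ha0; move: (laguerreB a0 c) => B coefB.
rewrite (nodal_recurrence a0 n) !coefD !coefZ !coef_sum !coefB !mulrDr pochhammerS.
congr (_ + _ + _); [by ring|by ring|].
rewrite mulr_sumr !big_nat; apply: eq_bigr => j /andP[j0 jp].
rewrite !coefZ; case: leqP => [jn|_]; last by rewrite coef0 !mulr0.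
rewrite rec_coef_newton // coefB.
have -> : pochhammer (a0 + 1) n = pochhammer (a0 + 1) (n - j) *
    pochhammer (a0 + n%:R - j%:R + 1) j.
  rewrite -[in LHS](subnK jn) pochhammerD natrB //.
  by congr (_ * pochhammer _ _); ring.
by ring.
Qed.

End TypeIIRecurrence.

(** * Power series up to a given order *)

Section Truncation.
Variable T : comRingType.
Implicit Types (f g h : {poly T}) (m k : nat).

(** Congruence modulo 'X^m: polynomials stand for formal power series of which
    only the coefficients below m matter.  The derivative loses one order. *)
Definition agree m f g := forall k, (k < m)%N -> f`_k = g`_k.

Lemma agree_sym m f g : agree m f g -> agree m g f.
Proof. by move=> fg k km; rewrite fg. Qed.

Lemma agree_trans m g f h : agree m f g -> agree m g h -> agree m f h.
Proof. by move=> fg gh k km; rewrite fg // gh. Qed.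

Lemma agree_leq m m' f g : (m' <= m)%N -> agree m f g -> agree m' f g.
Proof. by move=> mm fg k km; rewrite fg // (leq_trans km). Qed.

Lemma agreeD m f f' g g' : agree m f f' -> agree m g g' -> agree m (f + g) (f' + g').
Proof. by move=> ff gg k km; rewrite !coefD ff // gg. Qed.

Lemma agreeM m f f' g g' : agree m f f' -> agree m g g' -> agree m (f * g) (f' * g').
Proof.
move=> ff gg k km; rewrite !coefM; apply: eq_bigr => j _.
by rewrite ff ?gg //; have := ltn_ord j; lia.
Qed.

Lemma agreeX m f g n : agree m f g -> agree m (f ^+ n) (g ^+ n).
Proof.
by move=> fg; elim: n => [|n IHn] //; rewrite !exprS; exact: agreeM.
Qed.

Lemma agree_prod m (I : Type) (s : seq I) (P : pred I) (F G : I -> {poly T}) :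
  (forall j, P j -> agree m (F j) (G j)) ->
  agree m (\prod_(j <- s | P j) F j) (\prod_(j <- s | P j) G j).
Proof.
by move=> FG; apply: (big_ind2 (agree m)) => // f f' g g'; exact: agreeM.
Qed.

Lemma agree_deriv m f g : agree m f g -> agree m.-1 f^`() g^`().
Proof. by move=> fg k km; rewrite !coef_deriv fg //; lia. Qed.

Lemma agree_poly m n (F : nat -> T) : (m <= n)%N ->
  agree m (\poly_(k < n) F k) (\poly_(k < m) F k).
Proof. by move=> mn k km; rewrite !coef_poly km (leq_trans km mn). Qed.

End Truncation.

Lemma agree_map (T U : comRingType) (phi : {rmorphism T -> U}) m (f g : {poly T}) :
  agree m f g -> agree m (map_poly phi f) (map_poly phi g).
Proof. by move=> fg k km; rewrite !coef_map fg. Qed.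

(** * Type I polynomials as residues *)

Section TypeIKernel.
Variables (R : realType) (p : nat) (c : 'I_p -> R) (i : 'I_p).
Hypothesis hc : forall q, 0 < c q.
Hypothesis hcinj : injective c.
Implicit Types (b : R) (nu : 'I_p -> nat).

(** The binomial coefficient of a real b over k. *)
Definition gbinom b k : R := pochhammer (b - k%:R + 1) k / k`!%:R.

Lemma natrS_neq0 n : n.+1%:R != 0 :> R. Proof. by rewrite pnatr_eq0. Qed.
Lemma fact_neq0 n : n`!%:R != 0 :> R.
Proof. by rewrite pnatr_eq0 -lt0n fact_gt0. Qed.

Lemma pochhammerSl (x : R) n : pochhammer x n.+1 = x * pochhammer (x + 1) n.
Proof. by rewrite -add1n pochhammerD /pochhammer big_ord1 addr0. Qed.

Lemma gbinom0 b : gbinom b 0 = 1.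
Proof. by rewrite /gbinom pochhammer0 fact0 divr1. Qed.

Lemma gbinomS b k : k.+1%:R * gbinom b k.+1 = b * gbinom (b - 1) k.
Proof.
rewrite /gbinom pochhammerS factS natrM.
have -> : b - 1 - k%:R + 1 = b - k.+1%:R + 1 by rewrite -natr1; ring.
have n0 := natrS_neq0 k; have f0 := fact_neq0 k.
move: (pochhammer _ _) => P; field; rewrite f0 /= -?natr1 in n0 *.
by rewrite addrC.
Qed.

Lemma gbinom_pascal b k : gbinom (b + 1) k.+1 = gbinom b k.+1 + gbinom b k.
Proof.
rewrite /gbinom [in LHS]pochhammerS [in X in _ = X + _]pochhammerSl factS natrM.
have -> : b - k.+1%:R + 1 + 1 = b - k%:R + 1 by rewrite -natr1; ring.
have -> : b + 1 - k.+1%:R + 1 = b - k%:R + 1 by rewrite -natr1; ring.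
have n0 := natrS_neq0 k; have f0 := fact_neq0 k.
move: (pochhammer _ _) => P; field; rewrite f0 /= -?natr1 in n0 *.
by rewrite addrC.
Qed.

(** The truncated expansions in u = s - c_i of s^b, of 1 / (c_q - s) and of
    exp(-ux); in the last one the coefficients are polynomials in x. *)
Definition power_series m b : {poly R} :=
  \poly_(k < m) (gbinom b k * c i `^ (b - k%:R)).
Definition inv_series m q : {poly R} := \poly_(k < m) (c q - c i)^-1 ^+ k.+1.
Definition exp_series m : {poly {poly R}} :=
  \poly_(k < m) (((-1) ^+ k / k`!%:R) *: 'X^k).

Lemma powR_shift (b b' : R) : b' = b + 1 -> c i `^ b' = c i * c i `^ b.
Proof.
move=> ->; rewrite powRD ?powRr1 ?(ltW (hc i)) ?[c i * _]mulrC //.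
by rewrite (gt_eqF (hc i)) implybT.
Qed.

Lemma power_seriesM m b :
  agree m (((c i)%:P + 'X) * power_series m b) (power_series m (b + 1)).
Proof.
move=> k km; rewrite mulrDl coefD coefCM coefXM !coef_poly km.
case: k km => [|k] km /=.
  by rewrite !gbinom0 !mul1r addr0 !subr0 (powR_shift (erefl (b + 1))).
rewrite (ltnW km) gbinom_pascal.
have e1 : b + 1 - k.+1%:R = b - k.+1%:R + 1 by ring.
have e2 : b - k%:R = b - k.+1%:R + 1 by rewrite -natr1; ring.
by rewrite (powR_shift e1) (powR_shift e2); ring.
Qed.

Lemma deriv_power_series m b :
  agree m.-1 (power_series m b)^`() (b *: power_series m (b - 1)).
Proof.
move=> k km; rewrite coef_deriv coefZ !coef_poly ifT; last by lia.
rewrite ifT; last by lia.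
rewrite -[LHS]mulr_natl [LHS]mulrA gbinomS -mulrA; congr (_ * (_ * _ `^ _)).
by rewrite -natr1; ring.
Qed.

Lemma pole_neq0 q : q != i -> c q - c i != 0.
Proof. by move=> qi; rewrite subr_eq0; apply: contra_neq qi; exact: hcinj. Qed.

Lemma inv_seriesM m q : q != i ->
  agree m (((c q - c i)%:P - 'X) * inv_series m q) 1.
Proof.
move=> /pole_neq0 qi k km; rewrite mulrBl coefB coefCM coefXM coef1 !coef_poly km.
case: k km => [|k] km /=; first by rewrite expr1 subr0 divff.
by rewrite (ltnW km) exprS mulrA divff // mul1r subrr.
Qed.

Lemma inv_seriesXM m q n : q != i ->
  agree m (((c q - c i)%:P - 'X) * inv_series m q ^+ n.+1) (inv_series m q ^+ n).
Proof.
move=> qi; rewrite exprS mulrA -[X in agree _ _ X]mul1r.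
by apply: agreeM => //; exact: inv_seriesM.
Qed.

Lemma deriv_inv_series m q : q != i ->
  agree m.-1 (inv_series m q)^`() (inv_series m q ^+ 2).
Proof.
move=> qi; set w := inv_series m q; set l := (c q - c i)%:P - 'X.
have lw : agree m (l * w) 1 by exact: inv_seriesM.
have lw' : agree m.-1 (l * w) 1 by apply: agree_leq lw; exact: leq_pred.
have dlw : agree m.-1 (l * w^`()) w.
  have := agree_deriv lw; rewrite derivC derivM /l derivB derivC derivX sub0r.
  move=> h k km; have := h k km; rewrite coefD mulN1r coefN coef0 => /eqP.
  by rewrite addrC subr_eq0 => /eqP.
apply: (@agree_trans _ _ ((l * w) * w^`())).
  rewrite -[X in agree _ X _]mul1r; apply: agreeM => //; exact: agree_sym.
have -> : l * w * w^`() = w * (l * w^`()) by ring.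
by rewrite expr2; exact: agreeM.
Qed.

(** Induction through (c_q - s) * (c_q - s)^(-n-1) = (c_q - s)^(-n), read off
    coefficientwise. *)
Lemma coef_inv_seriesX m q n k : q != i -> (k < m)%N ->
  (inv_series m q ^+ n)`_k =
  pochhammer n%:R k / k`!%:R * (c q - c i)^-1 ^+ (n + k).
Proof.
move=> qi; have a0 := pole_neq0 qi.
elim: n k => [|n IHn] k km.
  rewrite coef1; case: k km => [|k] _; first by rewrite pochhammer0 divr1 mulr1.
  by rewrite pochhammerSl !mul0r.
elim: k km => [|k IHk] km.
  have := @inv_seriesXM m q n qi 0%N km.
  rewrite IHn // mulrBl coefB coefCM coefXM !pochhammer0 !addn0 fact0 divr1 !mul1r subr0.
  by move=> h; apply: (mulfI a0); rewrite h exprS mulVKf.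
have := @inv_seriesXM m q n qi k.+1 km.
rewrite IHn // mulrBl coefB coefCM coefXM /= (IHk (ltnW km)) => /eqP.
rewrite subr_eq => /eqP h.
apply: (mulfI a0); rewrite h.
rewrite pochhammerSl [X in _ = _ * (X / _ * _)]pochhammerS factS natrM !addnS !addSn !exprS.
rewrite natr1.
have n0 := natrS_neq0 k; have f0 := fact_neq0 k.
move: (pochhammer _ _) ((c q - c i)^-1 ^+ _) => P Q.
field; rewrite a0 f0 /= -?natr1 in n0 *.
by rewrite addrC.
Qed.

Lemma deriv_exp_series m :
  agree m.-1 (exp_series m)^`() (- 'X%:P * exp_series m).
Proof.
move=> k km; rewrite coef_deriv -polyCN coefCM !coef_poly ifT; last by lia.
rewrite ifT; last by lia.
have n0 := natrS_neq0 k; have f0 := fact_neq0 k.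
rewrite scalerMnl -[X in X *: _]mulr_natr factS natrM !exprS -scalerAr [- 'X * _]mulNr scalerN -[RHS]scaleNr.
congr (_ *: _); field; rewrite f0 /= -?natr1 in n0 *.
by rewrite addrC.
Qed.

Definition incr_at nu q : 'I_p -> nat := fun r => (nu r + (q == r))%N.

(** The expansion of s^b prod_(q <> i) (c_q - s)^(-nu_q); the factor q = i is
    the pole itself and enters through the order of the residue. *)
Definition kernel m b nu : {poly R} :=
  power_series m b * \prod_(q < p | q != i) inv_series m q ^+ nu q.
Definition exp_kernel m b nu : {poly {poly R}} :=
  exp_series m * map_poly polyC (kernel m b nu).
(** The residue at s = c_i of
    exp(-(s-c_i)x) s^b prod_q (c_q - s)^(-nu_q).
    As (c_i - s)^(-nu_i) = (-u)^(-nu_i), it is up to sign the coefficient of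
    u^(nu_i - 1) in [exp_kernel]; the truncation order nu_i + 1 is one of the
    admissible ones. *)
Definition pole_residue b nu : {poly R} :=
  if nu i == 0%N then 0 else
  (-1) ^+ nu i *: (exp_kernel (nu i).+1 b nu)`_(nu i).-1.

Lemma agree_exp_kernel m f g : agree m f g ->
  agree m (exp_series m * map_poly polyC f) (exp_series m * map_poly polyC g).
Proof. by move=> fg; apply: agreeM => //; exact: agree_map. Qed.

Lemma exp_kernel_leq m n b nu : (m <= n)%N ->
  agree m (exp_kernel n b nu) (exp_kernel m b nu).
Proof.
move=> mn; apply: agreeM; first exact: agree_poly.
apply: agree_map; apply: agreeM; first exact: agree_poly.
by apply: agree_prod => q _; apply: agreeX; exact: agree_poly.
Qed.

(** The truncation order does not matter, so that residues of different pole
    orders can be compared at a common one. *)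
Lemma pole_residueE m b nu : (0 < nu i)%N -> (nu i <= m)%N ->
  pole_residue b nu = (-1) ^+ nu i *: (exp_kernel m b nu)`_(nu i).-1.
Proof.
move=> n0 nm; rewrite /pole_residue gtn_eqF //; congr (_ *: _).
rewrite (@exp_kernel_leq (nu i) (nu i).+1) //; last by lia.
by rewrite (exp_kernel_leq b nu nm) //; lia.
Qed.

Lemma pole_residue0 b nu : nu i = 0%N -> pole_residue b nu = 0.
Proof. by rewrite /pole_residue => ->. Qed.

Lemma kernel_incr m b nu q : q != i ->
  kernel m b (incr_at nu q) = kernel m b nu * inv_series m q.
Proof.
move=> qi; rewrite /kernel (bigD1 q) //= [in RHS](bigD1 q) //= /incr_at eqxx addn1 exprSr.
rewrite (eq_bigr (fun r => inv_series m r ^+ nu r)); first by ring.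
by move=> r /andP[_ /negbTE]; rewrite eq_sym => ->; rewrite addn0.
Qed.

Lemma kernel_incr_self m b nu : kernel m b (incr_at nu i) = kernel m b nu.
Proof.
rewrite /kernel; congr (_ * _); apply: eq_bigr => r /negbTE ri.
by rewrite /incr_at eq_sym ri addn0.
Qed.

Lemma kernelS m b nu : agree m (kernel m (b + 1) nu) (((c i)%:P + 'X) * kernel m b nu).
Proof.
by rewrite /kernel mulrA; apply: agreeM => //; apply: agree_sym; exact: power_seriesM.
Qed.

Lemma kernel_pole m b nu q : q != i ->
  agree m (((c q - c i)%:P - 'X) * kernel m b (incr_at nu q)) (kernel m b nu).
Proof.
move=> qi; rewrite kernel_incr // mulrC -mulrA -[X in agree _ _ X]mulr1.
by apply: agreeM => //; rewrite mulrC; exact: inv_seriesM.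
Qed.

(** The logarithmic derivative of the kernel is
    b/s + sum_(q <> i) nu_q / (c_q - s). *)
Lemma deriv_kernel m b nu :
  agree m.-1 (kernel m b nu)^`()
    (b *: kernel m (b - 1) nu
     + \sum_(q < p | q != i) (nu q)%:R *: kernel m b (incr_at nu q)).
Proof.
(* logarithmic derivatives turn products into sums *)
have dW : agree m.-1 (\prod_(q < p | q != i) inv_series m q ^+ nu q)^`()
   ((\prod_(q < p | q != i) inv_series m q ^+ nu q) *
    (\sum_(q < p | q != i) (nu q)%:R *: inv_series m q)).
  apply: (big_ind2 (fun f g => agree m.-1 f^`() (f * g))).
  - by rewrite derivC mulr0.
  - move=> f g f' g' df df'; rewrite derivM.
    have -> : f * f' * (g + g') = (f * g) * f' + f * (f' * g') by ring.
    by apply: agreeD; apply: agreeM.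
  - move=> q qi; rewrite deriv_exp.
    case: (nu q) => [|n]; first by rewrite mulr0n scale0r mulr0.
    rewrite -pred_Sn -mulr_natl -mul_polyC polyCMn exprS.
    have -> : inv_series m q * inv_series m q ^+ n * (1%:P *+ n.+1 * inv_series m q) =
       n.+1%:R * (inv_series m q ^+ 2 * inv_series m q ^+ n).
      by rewrite polyC1; ring.
    apply: agreeM => //; apply: agreeM => //; exact: deriv_inv_series.
rewrite /kernel derivM; apply: agreeD.
  rewrite scalerAl; apply: agreeM => //; exact: deriv_power_series.
have -> : \sum_(q < p | q != i) (nu q)%:R *: (power_series m b *
      \prod_(r < p | r != i) inv_series m r ^+ incr_at nu q r) =
   power_series m b * ((\prod_(q < p | q != i) inv_series m q ^+ nu q) *
    (\sum_(q < p | q != i) (nu q)%:R *: inv_series m q)).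
  rewrite mulrA mulr_sumr; apply: eq_bigr => q qi.
  by rewrite -scalerAr; congr (_ *: _); exact: kernel_incr.
exact: agreeM.
Qed.

Lemma map_polyC_CX (a : R) (f : {poly R}) :
  map_poly polyC ((a%:P + 'X) * f) = (a%:P%:P + 'X) * map_poly polyC f.
Proof. by rewrite rmorphM rmorphD /= map_polyC map_polyX. Qed.

Lemma coef_CXM (T : comRingType) (a : T) (f : {poly T}) k :
  ((a%:P + 'X) * f)`_k = a * f`_k + (if k == 0%N then 0 else f`_k.-1).
Proof. by rewrite mulrDl coefD coefCM coefXM. Qed.

(** The residue of s + (c_q - s) = c_q times the function with exponents b and
    [incr_at nu q].  For q = i, multiplying by c_i - s = -u lowers the order of
    the pole; for q <> i it is a relation between kernels. *)
Lemma pole_residue_mul b nu q :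
  pole_residue (b + 1) (incr_at nu q) + pole_residue b nu =
  c q *: pole_residue b (incr_at nu q).
Proof.
have [->|qi] := eqVneq q i.
  have ni : incr_at nu i i = (nu i).+1 by rewrite /incr_at eqxx addn1.
  pose m := (nu i).+1.
  rewrite ![pole_residue _ (incr_at _ _)](@pole_residueE m) ?ni //.
  have h : (exp_kernel m (b + 1) (incr_at nu i))`_(nu i) =
     c i *: (exp_kernel m b nu)`_(nu i)
     + (if nu i == 0%N then 0 else (exp_kernel m b nu)`_(nu i).-1).
    rewrite /exp_kernel kernel_incr_self (agree_exp_kernel (@kernelS m b nu)) //.
    by rewrite map_polyC_CX mulrCA coef_CXM mul_polyC.
  have k : exp_kernel m b (incr_at nu i) = exp_kernel m b nu.
    by rewrite /exp_kernel kernel_incr_self.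
  rewrite /= h k.
  have [n0|n0] := posnP (nu i).
    rewrite (pole_residue0 _ n0) !addr0 !scalerA; congr (_ *: _); exact: mulrC.
  rewrite (@pole_residueE m) // exprS -!mul_polyC !(polyCM, polyCN); ring.
have ni r : incr_at r q i = r i by rewrite /incr_at (negbTE qi) addn0.
have [n0|n0] := posnP (nu i); first by rewrite !pole_residue0 ?ni // scaler0 addr0.
rewrite !(@pole_residueE (nu i)) ?ni //.
rewrite -scalerDr scalerA mulrC -scalerA; congr (_ *: _).
have h : agree (nu i) (kernel (nu i) (b + 1) (incr_at nu q) + kernel (nu i) b nu)
                      ((c q)%:P * kernel (nu i) b (incr_at nu q)).
  have -> : (c q)%:P * kernel (nu i) b (incr_at nu q) =
    ((c i)%:P + 'X) * kernel (nu i) b (incr_at nu q) +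
    ((c q - c i)%:P - 'X) * kernel (nu i) b (incr_at nu q) by rewrite polyCB; ring.
  by apply: agreeD; [exact: kernelS|apply: agree_sym; exact: kernel_pole].
rewrite -coefD /exp_kernel -mulrDr -rmorphD /= (agree_exp_kernel h); last by lia.
by rewrite rmorphM /= map_polyC mulrCA coefCM mul_polyC.
Qed.

(** The residue of an s-derivative is zero: with F the remaining factor,
    x exp(-ux) F = - d/du (exp(-ux) F) + exp(-ux) F', and F' comes from
    b/s + sum_q nu_q / (c_q - s).  The term q = i arises from differentiating
    the pole, here as the factor nu_i of the coefficient of u^(nu_i). *)
Lemma pole_residue_deriv b nu :
  'X * pole_residue b nu =
  b *: pole_residue (b - 1) nu
  + \sum_(q < p) (nu q)%:R *: pole_residue b (incr_at nu q).
Proof.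
rewrite (bigD1 i) //=.
have ni q : q != i -> incr_at nu q i = nu i by move=> qi; rewrite /incr_at (negbTE qi) addn0.
have nii : incr_at nu i i = (nu i).+1 by rewrite /incr_at eqxx addn1.
have [n0|n0] := posnP (nu i).
  rewrite n0 scale0r add0r !pole_residue0 // mulr0 scaler0 add0r big1 // => q qi.
  by rewrite pole_residue0 ?scaler0 // ni.
pose m := (nu i).+1.
have nm : (nu i <= m)%N by rewrite leqnSn.
rewrite [pole_residue b nu](@pole_residueE m) // [pole_residue (b - 1) nu](@pole_residueE m) //.
rewrite [pole_residue b (incr_at nu i)](@pole_residueE m) ?nii //.
rewrite (eq_bigr (fun q => (-1) ^+ nu i *: ((nu q)%:R *: (exp_kernel m b (incr_at nu q))`_(nu i).-1))).
  2: by move=> q qi; rewrite (@pole_residueE m) ?ni // !scalerA mulrC.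
rewrite -scaler_sumr.
have -> : exp_kernel m b (incr_at nu i) = exp_kernel m b nu.
  by rewrite /exp_kernel kernel_incr_self.
have lt : ((nu i).-1 < m.-1)%N by rewrite /m /=; lia.
have E1 : (exp_kernel m b nu)^`()`_(nu i).-1 =
  - 'X * (exp_kernel m b nu)`_(nu i).-1
  + (b *: (exp_kernel m (b - 1) nu)`_(nu i).-1 +
    \sum_(q < p | q != i) (nu q)%:R *: (exp_kernel m b (incr_at nu q))`_(nu i).-1).
  rewrite {1}/exp_kernel derivM coefD; congr (_ + _).
    have h : agree m.-1 ((exp_series m)^`() * map_poly polyC (kernel m b nu))
        (- 'X%:P * exp_series m * map_poly polyC (kernel m b nu)).
      by apply: agreeM => //; exact: deriv_exp_series.
    by rewrite h // -mulrA -polyCN coefCM.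
  have h : agree m.-1 (exp_series m * map_poly polyC (kernel m b nu)^`())
      (exp_series m * map_poly polyC (b *: kernel m (b - 1) nu
         + \sum_(q < p | q != i) (nu q)%:R *: kernel m b (incr_at nu q))).
    by apply: agreeM => //; apply: agree_map; exact: deriv_kernel.
  rewrite deriv_map h //.
  rewrite rmorphD rmorph_sum /= mulrDr coefD mulr_sumr coef_sum.
  congr (_ + _).
    by rewrite -mul_polyC rmorphM /= map_polyC mulrCA coefCM mul_polyC.
  apply: eq_bigr => q _.
  by rewrite -mul_polyC rmorphM /= map_polyC mulrCA coefCM mul_polyC.
have E2 : 'X * (exp_kernel m b nu)`_(nu i).-1 =
    b *: (exp_kernel m (b - 1) nu)`_(nu i).-1 +
    \sum_(q < p | q != i) (nu q)%:R *: (exp_kernel m b (incr_at nu q))`_(nu i).-1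
    - (nu i)%:R *: (exp_kernel m b nu)`_(nu i).
  move: E1; set V := (b *: _ + _); rewrite coef_deriv prednK // => E1.
  have -> : V = (exp_kernel m b nu)`_(nu i) *+ nu i + 'X * (exp_kernel m b nu)`_(nu i).-1.
    by rewrite E1; ring.
  by rewrite scaler_nat; ring.
rewrite -scalerAr E2 /= exprS -!mul_polyC !(polyCM, polyCN); ring.
Qed.

(** The multiple sum is the Cauchy product of the expansions: l_q is the
    exponent of u taken in factor q, the index l_i belongs to exp(-ux) and
    carries x^(l_i), and s^b receives the remaining exponent. *)
Lemma coef_exp_kernel b nu : (0 < nu i)%N ->
  (exp_kernel (nu i) b nu)`_(nu i).-1 =
  \sum_(l : {ffun 'I_p -> 'I_(nu i)} | (\sum_(q < p) l q <= nu i - 1)%N)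
    ((-1) ^+ l i / (l i)`!%:R
     * (gbinom b (nu i - 1 - \sum_(q < p) l q)
        * c i `^ (b - (nu i - 1 - \sum_(q < p) l q)%N%:R))
     * \prod_(q < p | q != i)
         (pochhammer (nu q)%:R (l q) / (l q)`!%:R * (c q - c i)^-1 ^+ (nu q + l q)))
    *: 'X^(l i).
Proof.
move=> n0; set n := nu i.
pose v (q : 'I_p) k : R :=
  pochhammer (nu q)%:R k / k`!%:R * (c q - c i)^-1 ^+ (nu q + k).
pose f (q : 'I_p) k : {poly R} :=
  if q == i then ((-1) ^+ k / k`!%:R) *: 'X^k else (v q k)%:P.
pose F q := \poly_(k < n) f q k.
have h : agree n (exp_kernel n b nu)
    (map_poly polyC (power_series n b) * \prod_(q < p) F q).
  rewrite /exp_kernel /kernel rmorphM rmorph_prod /= mulrCA [\prod_(q < p) F q](bigD1 i) //=.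
  apply: agreeM => //; apply: agreeM.
    by rewrite /F /f eqxx.
  apply: agree_prod => q qi k kn.
  by rewrite coef_map coef_inv_seriesX // /F /f (negbTE qi) coef_poly kn.
rewrite h; last by rewrite prednK.
have -> : \prod_(q < p) F q =
    \sum_(l : {ffun 'I_p -> 'I_n}) (\prod_(q < p) f q (l q)) *: 'X^(\sum_(q < p) l q)%N.
  under eq_bigr do rewrite /F poly_def.
  rewrite bigA_distr_bigA; apply: eq_bigr => l _.
  by rewrite scaler_prod !expr_sum.
rewrite mulr_sumr coef_sum [RHS]big_mkcond /=; apply: eq_bigr => l _.
rewrite -scalerAr coefZ coefMXn subn1 ltnNge; case: leqP => [ln|]; last by rewrite mulr0.
rewrite coef_map coef_poly ifT /=; last by lia.
rewrite (bigD1 i) //= {1}/f eqxx.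
rewrite (eq_bigr (fun q => (v q (l q))%:P)); last first.
  by move=> q qi; rewrite /f (negbTE qi).
by rewrite -rmorph_prod /= /v -!mul_polyC !polyCM; ring.
Qed.

(** Termwise comparison of [coef_exp_kernel] with the definition, where
    N = nu_i - 1 and g = a0 + |nu| - N: the binomial coefficient of s^b is
    (g)_N / (g)_L / (N-L)!, the signs of the factors multiply to (-1)^L, and
    together with N! / (N-L)! this is (-N)_L. *)
Lemma laguerreI_pole_residue (a0 : R) nu : -1 < a0 ->
  laguerreI a0 c i nu =
  (- (Gamma (a0 + (msize nu)%:R))^-1 * \prod_(q < p) c q ^+ nu q) *:
  pole_residue (a0 + (msize nu)%:R - 1) nu.
Proof.
move=> ha0; rewrite /laguerreI; case: eqP => [n0|/eqP].
  by rewrite pole_residue0 // scaler0.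
rewrite -lt0n => n0; rewrite (@pole_residueE (nu i)) // coef_exp_kernel //.
rewrite !scalerA !scaler_sumr; apply: eq_bigr => l; set L := (\sum_(q < p) l q)%N => lN.
rewrite !scalerA; congr (_ *: _).
set n := nu i in n0 l @L lN *; set A := a0 + _.
have nM : (n <= msize nu)%N by rewrite /msize (bigD1 i) //= leq_addr.
have g0 : 0 < A - n%:R + 1.
  have : n%:R <= (msize nu)%:R :> R by rewrite ler_nat.
  by rewrite /A; lra.
set g := A - n%:R + 1 in g0 *.
set N := (n - 1)%N in lN *.
have nE : n = N.+1 by rewrite /N; lia.
have binE : gbinom (A - 1) (N - L) =
    pochhammer g N / pochhammer g L / (N - L)`!%:R.
  rewrite /gbinom.
  have -> : A - 1 - (N - L)%N%:R + 1 = g + L%:R.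
    by rewrite natrB // /g nE -natr1; ring.
  have := pochhammerD g L (N - L); rewrite subnKC // => ->.
  by rewrite [pochhammer g L * _]mulrC mulfK // gt_eqF // pochhammer_gt0.
have powE : c i `^ (A - 1 - (N - L)%N%:R) * c i ^+ n = c i `^ A * c i ^+ L.
  rewrite -!powR_mulrn ?ltW // -!powRD ?(gt_eqF (hc i)) ?implybT //.
  by congr (_ `^ _); rewrite natrB // nE -natr1; ring.
have pochN : pochhammer (- n%:R + 1) L = (-1) ^+ L * (N`!%:R / (N - L)`!%:R) :> R.
  have -> : - n%:R + 1 = - N%:R :> R by rewrite nE -natr1; ring.
  by rewrite pochhammer_neg -(ffact_fact lN) natrM mulfK // fact_neq0.
have signE : (-1) ^+ L = (-1) ^+ l i * \prod_(q < p | q != i) (-1) ^+ l q :> R.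
  by rewrite /L expr_sum (bigD1 i).
have prodE : \prod_(q < p | q != i) c q ^+ nu q *
  \prod_(q < p | q != i)
    (pochhammer (nu q)%:R (l q) / (l q)`!%:R * (c q - c i)^-1 ^+ (nu q + l q)) =
  (\prod_(q < p | q != i) (-1) ^+ l q) *
  \prod_(q < p | q != i) (c q / (c q - c i)) ^+ nu q *
  \prod_(q < p | q != i)
     (pochhammer (nu q)%:R (l q) / ((l q)`!%:R * (c i - c q) ^+ l q)).
  rewrite -!big_split /=; apply: eq_bigr => q qi.
  have ciq : c i - c q = - (c q - c i) by ring.
  rewrite exprD exprMn invfM -exprVn ciq invrN (exprNn (c q - c i)^-1).
  set s := (-1) ^+ l q; have s2 : s * s = 1 by rewrite -expr2 sqrr_sign.
  set P := pochhammer _ _; set u := _ ^-1 ^+ nu q; set w := _ ^-1 ^+ l q.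
  transitivity ((s * s) * (c q ^+ nu q * u * (P * (l q)`!%:R^-1 * w))).
    by rewrite s2; ring.
  by ring.
rewrite pochN signE binE [\prod_(q < p) c q ^+ nu q](bigD1 i) //= -/n.
rewrite invfM [in (-1) ^+ n]nE exprS.
move: prodE powE; set cp := \prod_(q < p | q != i) c q ^+ nu q.
set V := \prod_(q < p | q != i) (_ * _ ^+ (_ + _)).
set sg := \prod_(q < p | q != i) (-1) ^+ _.
set X := \prod_(q < p | q != i) (_ / _) ^+ _.
set Y := \prod_(q < p | q != i) (_ / (_ * _)).
set Z := c i `^ (A - 1 - _) => prodE powE.
have fN := fact_neq0 N.
transitivity ((-1) ^+ N * (-1) ^+ l i / (l i)`!%:R * (Gamma A)^-1 *
  (pochhammer g N / pochhammer g L / (N - L)`!%:R) * (c i `^ A * c i ^+ L) * (sg * X * Y) *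
  (N`!%:R / N`!%:R)); first by ring.
by rewrite divff // mulr1 -prodE -powE; ring.
Qed.

End TypeIKernel.

(** * The type I recurrence *)

Section TypeIRecurrence.
Variables (R : realType) (p : nat) (hp : (0 < p)%N) (c : 'I_p -> R) (i : 'I_p).
Hypothesis hc : forall q, 0 < c q.
Hypothesis hcinj : injective c.
Implicit Types (g : R) (nu : 'I_p -> nat) (a b : 'I_p).
Local Notation node := (node hp c).
Local Notation newton_coef := (newton_coef hp c).
Local Notation pole_residue := (pole_residue c i).

(** The residue at s = c_i of exp(-(s-c_i)x) s^g prod_q (1/s - 1/c_q)^(-nu_q):
    in this normalization [typeI_mul] is multiplication by t - d_a, and lowering
    g by one is multiplication by t = 1/s. *)
Definition typeI g nu : {poly R} :=
  (\prod_(q < p) c q ^+ nu q) *: pole_residue (g + (msize nu)%:R) nu.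

Lemma msize_incr nu a : msize (incr_at nu a) = (msize nu).+1.
Proof.
rewrite /msize /incr_at big_split /= -addn1; congr (_ + _)%N.
rewrite (bigD1 a) //= eqxx big1 ?addn0 // => q /negbTE; by rewrite eq_sym => ->.
Qed.

Lemma prod_incr nu a :
  \prod_(q < p) c q ^+ incr_at nu a q = c a * \prod_(q < p) c q ^+ nu q.
Proof.
rewrite /incr_at; under eq_bigr do rewrite exprD.
rewrite big_split /= mulrC; congr (_ * _).
rewrite (bigD1 a) //= eqxx expr1 big1 ?mulr1 // => q /negbTE.
by rewrite eq_sym => ->.
Qed.

Lemma typeI_mul g nu a :
  typeI (g - 1) (incr_at nu a) = typeI g nu + (c a)^-1 *: typeI g (incr_at nu a).
Proof.
rewrite /typeI msize_incr prod_incr -natr1.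
have -> : g - 1 + ((msize nu)%:R + 1) = g + (msize nu)%:R by ring.
rewrite addrA scalerA mulKf ?gt_eqF // -scalerDr [X in _ = _ *: X]addrC.
by rewrite (pole_residue_mul i hc hcinj) scalerA [_ * c a]mulrC.
Qed.

Lemma typeI_deriv g nu :
  'X * typeI g nu = (g + (msize nu)%:R) *: typeI (g - 1) nu
  + \sum_(a < p) ((nu a)%:R * (c a)^-1) *: typeI (g - 1) (incr_at nu a).
Proof.
rewrite /typeI -scalerAr (pole_residue_deriv i hcinj) scalerDr !scalerA.
have -> : g - 1 + (msize nu)%:R = g + (msize nu)%:R - 1 by ring.
rewrite [(g + _) * _]mulrC; congr (_ + _).
rewrite scaler_sumr; apply: eq_bigr => a _; rewrite msize_incr prod_incr -natr1 !scalerA.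
have -> : g - 1 + ((msize nu)%:R + 1) = g + (msize nu)%:R by ring.
by congr (_ *: _); rewrite -mulrA mulKf ?gt_eqF // mulrC.
Qed.

Lemma incr_atC nu a b : incr_at (incr_at nu a) b = incr_at (incr_at nu b) a.
Proof. by apply/funext => q; rewrite /incr_at addnAC. Qed.

Lemma incr_at_stepline n : incr_at (stepline p n) (step_dir hp n) = stepline p n.+1.
Proof. by apply/funext => q; rewrite (steplineS hp). Qed.

(** 1/(t-d_a) = 1/(t-d_b) + (d_a-d_b) / ((t-d_b)(t-d_a)). *)
Lemma typeI_exchange g nu a b :
  typeI g (incr_at nu a) =
  typeI g (incr_at nu b) + ((c a)^-1 - (c b)^-1) *: typeI g (incr_at (incr_at nu b) a).
Proof.
have := typeI_mul g (incr_at nu a) b; rewrite incr_atC typeI_mul => h.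
rewrite scalerBl addrA h; ring.
Qed.

(** J steps of the Newton expansion of 1/(t-d_a) along the nodes that follow
    step n. *)
Lemma typeI_partial g n a J :
  typeI g (incr_at (stepline p n) a) =
  \sum_(1 <= j < J.+1)
     \prod_(n <= r < n + j - 1) ((c a)^-1 - node r) *: typeI g (stepline p (n + j))
  + \prod_(n <= r < n + J) ((c a)^-1 - node r) *:
     typeI g (incr_at (stepline p (n + J)) a).
Proof.
elim: J => [|J IHJ].
  by rewrite [X in _ = X + _]big_geq // add0r addn0 big_geq // scale1r.
rewrite IHJ [in RHS]big_nat_recr //= -addrA; congr (_ + _).
rewrite (typeI_exchange g _ a (step_dir hp (n + J))) incr_at_stepline.
rewrite [in RHS]addnS subn1 /= scalerDr scalerA; congr (_ + _ *: _).
by rewrite big_nat_recr //= leq_addr.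
Qed.

(** The p nodes following step n include d_a, which kills the remainder. *)
Lemma typeI_newton g n a :
  typeI g (incr_at (stepline p n) a) =
  \sum_(1 <= j < p.+1)
     \prod_(n <= r < n + j - 1) ((c a)^-1 - node r) *: typeI g (stepline p (n + j)).
Proof.
rewrite (typeI_partial g n a p) node_prod_eq0 ?scale0r ?addr0 //.
by rewrite steplineDp.
Qed.

(** The type I recurrence before division by the Gamma function.  The
    coefficient of the term j refers to the multi-index of step n+j-1 instead of
    n; the two differ only in entries a for which d_a is among the nodes
    e_n, ..., e_(n+j-2), where the product of differences is zero. *)
Lemma typeI_recurrence (a0 : R) n : (0 < n)%N ->
  'X * typeI (a0 - 1) (stepline p n) =
  (a0 - 1 + n%:R) *: typeI (a0 - 1) (stepline p (n - 1))
  + rec_coef hp a0 c 0 (n - 1) *: typeI (a0 - 1) (stepline p n)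
  + \sum_(1 <= j < p.+1)
      newton_coef j (n + j - 1) *: typeI (a0 - 1) (stepline p (n + j)).
Proof.
case: n => // n _; rewrite subn1 /=.
set g := a0 - 1.
rewrite typeI_deriv msize_stepline //.
rewrite -{1}incr_at_stepline typeI_mul incr_at_stepline.
have -> : \sum_(a < p) ((stepline p n.+1 a)%:R / c a) *:
     typeI (g - 1) (incr_at (stepline p n.+1) a) =
   (\sum_(a < p) (stepline p n.+1 a)%:R / c a) *: typeI g (stepline p n.+1) +
   \sum_(a < p) ((stepline p n.+1 a)%:R / c a / c a) *:
       typeI g (incr_at (stepline p n.+1) a).
  rewrite scaler_suml -big_split; apply: eq_bigr => a _ /=.
  by rewrite typeI_mul scalerDr scalerA.
have -> : \sum_(a < p) ((stepline p n.+1 a)%:R / c a / c a) *: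
       typeI g (incr_at (stepline p n.+1) a) =
    \sum_(1 <= j < p.+1)
      newton_coef j (n.+1 + j - 1) *: typeI g (stepline p (n.+1 + j)).
  under [RHS]eq_bigr do rewrite scaler_suml.
  rewrite exchange_big /=; apply: eq_bigr => a _.
  rewrite typeI_newton scaler_sumr !big_nat; apply: eq_bigr => j /andP[j0 _].
  rewrite scalerA; congr (_ *: _).
  have -> : ((n.+1 + j - 1).+1 - j = n.+1)%N by lia.
  rewrite expr2 !mulrA.
  have le : (n.+1 <= n.+1 + j - 1)%N by lia.
  have := stepline_nondecr hp a le; rewrite leq_eqVlt => /orP[/eqP ->//|lt].
  by rewrite (node_prod_eq0 _ _ lt) !mulr0.
have -> : \sum_(a < p) (stepline p n.+1 a)%:R / c a =
   node n + \sum_(a < p) (stepline p n a)%:R / c a.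
  under eq_bigr do rewrite (steplineS hp) natrD mulrDl.
  rewrite big_split /= addrC; congr (_ + _).
  rewrite (bigD1 (step_dir hp n)) //= eqxx mul1r big1 ?addr0 // => a /negbTE.
  by rewrite eq_sym => ->; rewrite mul0r.
rewrite addrA; congr (_ + _).
rewrite rec_coef0 /g -natr1 -!mul_polyC !(polyCM, polyCD, polyCN); ring.
Qed.

Lemma laguerreA_typeI (a0 : R) n : -1 < a0 ->
  laguerreA a0 c i n = - (Gamma (a0 + n%:R))^-1 *: typeI (a0 - 1) (stepline p n).
Proof.
move=> ha0; rewrite /laguerreA laguerreI_pole_residue // /typeI msize_stepline // scalerA.
by have -> : a0 + n%:R - 1 = a0 - 1 + n%:R by ring.
Qed.

Lemma typeI_stepline0 g : typeI g (stepline p 0) = 0.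
Proof. by rewrite /typeI pole_residue0 ?scaler0 // stepline0. Qed.

Lemma laguerreA_recurrence (a0 : R) n : -1 < a0 -> (0 < n)%N ->
  'X * laguerreA a0 c i n =
  laguerreA a0 c i (n - 1) + rec_coef hp a0 c 0 (n - 1) *: laguerreA a0 c i n
  + \sum_(1 <= j < p.+1)
      rec_coef hp a0 c j (n + j - 1) *: laguerreA a0 c i (n + j).
Proof.
move=> ha0 n0; have c0 q : c q != 0 by rewrite gt_eqF.
pose T m := typeI (a0 - 1) (stepline p m).
pose G m : R := - (Gamma (a0 + m%:R))^-1.
have EA m : laguerreA a0 c i m = G m *: T m.
  exact: laguerreA_typeI.
have T0 : T 0%N = 0 by exact: typeI_stepline0.
have recT : 'X * T n = (a0 - 1 + n%:R) *: T (n - 1)%N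
    + rec_coef hp a0 c 0 (n - 1) *: T n
    + \sum_(1 <= j < p.+1) newton_coef j (n + j - 1) *: T (n + j)%N.
  exact: typeI_recurrence.
have GD m j : (0 < m)%N -> G m = pochhammer (a0 + m%:R) j * G (m + j)%N.
  move=> m0; have am0 : 0 < a0 + m%:R.
    by have : 1 <= m%:R :> R by [rewrite ler1n]; lra.
  have pj : pochhammer (a0 + m%:R) j != 0 by rewrite gt_eqF // pochhammer_gt0.
  by rewrite /G natrD addrA (GammaD j am0) invfM mulrN mulrA mulfV // mul1r.
clearbody T G; move: (laguerreA a0 c i) EA => A EA.
rewrite !EA -scalerAr recT !scalerDr; congr (_ + _ + _).
- case: (n) n0 => // -[|m] _; first by rewrite subnn T0 !scaler0.
  rewrite subn1 /= scalerA; congr (_ *: _).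
  rewrite (GD m.+1 1%N) // addn1 mulrC /pochhammer big_ord1 addr0.
  by congr (_ * _); rewrite -[m.+2%:R]natr1; ring.
- by rewrite !scalerA [X in X *: _]mulrC.
rewrite scaler_sumr !big_nat; apply: eq_bigr => j /andP[j0 jp].
rewrite EA !scalerA rec_coef_newton //; last by lia.
have -> : a0 + (n + j - 1)%N%:R - j%:R + 1 = a0 + n%:R.
  by rewrite natrB ?natrD; [ring|lia].
by rewrite (GD n j) //; congr (_ *: _); ring.
Qed.

End TypeIRecurrence.

Theorem corollary4p2 (R : realType) (p : nat) (hp : (0 < p)%N) (a0 : R)
    (ha0 : -1 < a0) (c : 'I_p -> R) (hc : forall i, 0 < c i)
    (hcinj : injective c) :
  (forall n : nat,
     'X * laguerreB a0 c n =
     laguerreB a0 c n.+1 + rec_coef hp a0 c 0 n *: laguerreB a0 c n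
     + \sum_(1 <= j < p.+1)
         rec_coef hp a0 c j n *:
           (if (j <= n)%N then laguerreB a0 c (n - j) else 0)) /\
  (forall (n : nat) (i : 'I_p), (1 <= n)%N ->
     'X * laguerreA a0 c i n =
     laguerreA a0 c i (n - 1) + rec_coef hp a0 c 0 (n - 1) *: laguerreA a0 c i n
     + \sum_(1 <= j < p.+1)
         rec_coef hp a0 c j (n + j - 1) *: laguerreA a0 c i (n + j)).
Proof.
split=> [n|n i n0]; last exact: laguerreA_recurrence.
by apply: laguerreB_recurrence => // q; rewrite gt_eqF.
Qed.
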